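(* Order $\mathbb{Q}$ by the Stern-Brocot enumeration extended to all rationals, i.e. as $0, q_1, -q_1, q_2, -q_2, \dots$ where $q_1,q_2,\dots$ is the Stern-Brocot enumeration of $\mathbb{Q}^+$. Then with respect to this ordering the asymptotic density in $\mathbb{Q}$ of each of the parity classes $\mathbb{Q}_\mathrm{E}$, $\mathbb{Q}_\mathrm{O}$, $\mathbb{Q}_\mathrm{N}$ is $\frac{1}{3}$.
   Context: Write each rational in lowest terms $m/n$ with $n>0$, $\gcd(m,n)=1$. Its parity is: even if $m$ is even (hence $n$ odd; in particular $0=0/1$ is even); odd if $m$ and $n$ are both odd; none if $n$ is even. $\mathbb{Q}_\mathrm{E},\mathbb{Q}_\mathrm{O},\mathbb{Q}_\mathrm{N}$ are the sets of rationals of parity even, odd, none respectively. The Stern-Brocot process: level $0$ is the sequence $0/1,\ 1/0$; level $j+1$ is obtained from level $j$ by inserting, between every two adjacent entries $m_1/n_1$ and $m_2/n_2$, their mediant $(m_1+m_2)/(n_1+n_2)$, keeping all existing entries. Every positive rational appears exactly once as a newly inserted entry (in lowest terms). The Stern-Brocot enumeration $q_1,q_2,\dots$ of $\mathbb{Q}^+$ lists the entries newly inserted at level $1$, then those newly inserted at level $2$, and so on, each level's new entries from left to right. For a countable set $X$ enumerated as $x_1,x_2,\dots$ and $A\subseteq X$, the asymptotic density of $A$ in $X$ is $\rho_X(A)=\lim_{n\to\infty}|A\cap\{x_1,\dots,x_n\}|/n$ when the limit exists. *)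

(* Defs.v *)
From HB Require Import structures.
From mathcomp Require Import all_boot all_order all_algebra finmap.
From mathcomp Require Import all_classical all_reals all_analysis.

Set Implicit Arguments.
Unset Strict Implicit.
Unset Printing Implicit Defensive.

Import Order.TTheory GRing.Theory Num.Theory.
Import numFieldNormedType.Exports.

Local Open Scope classical_set_scope.
Local Open Scope ring_scope.

(* [numq x] and [denq x] are the numerator and the positive denominator of [x]
   in lowest terms. *)
Definition ratE : set rat := [set x | (2 %| numq x)%Z].
Definition ratO : set rat :=
  [set x | ~~ (2 %| numq x)%Z && ~~ (2 %| denq x)%Z].
Definition ratN : set rat := [set x | (2 %| denq x)%Z].

(* The formal fraction m/n is the pair (m, n), so that 1/0 is allowed. *)
Definition mediant (p q : nat * nat) : nat * nat :=
  ((p.1 + q.1)%N, (p.2 + q.2)%N).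

Fixpoint sb_refine (s : seq (nat * nat)) : seq (nat * nat) :=
  match s with
  | p :: ((q :: _) as t) => p :: mediant p q :: sb_refine t
  | _ => s
  end.

Fixpoint sb_level (j : nat) : seq (nat * nat) :=
  if j is i.+1 then sb_refine (sb_level i) else [:: (0, 1); (1, 0)]%N.

(* The entries inserted when [s] is refined, from left to right. *)
Definition sb_mediants (s : seq (nat * nat)) : seq (nat * nat) :=
  if s is p :: t then pairmap mediant p t else [::].

Definition sb_new (j : nat) : seq (nat * nat) :=
  if j is i.+1 then sb_mediants (sb_level i) else [::].

(* Indices start at 0: [sb_enum k] is q_(k+1).  Each level from 1 on inserts at
   least one entry, so levels 1, ..., k+1 contain at least k+1 new entries and
   the default value of [nth] is never used. *)
Definition sb_enum (k : nat) : rat :=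
  let p := nth (0, 1)%N (flatten [seq sb_new j | j <- iota 1 k.+1]) k in
  p.1%:R / p.2%:R.

(* The sequence 0, q_1, - q_1, q_2, - q_2, ... *)
Definition sb_enum_rat (n : nat) : rat :=
  if n is k.+1 then
    if odd k then - sb_enum k./2 else sb_enum k./2
  else 0.

(* [x] enumerates [X], with indices starting at 0, so [x @` `I_n] is the set of
   its first n values; the quotient for n = 0 is irrelevant to the limit. *)
Definition has_density (R : realType) (X : choiceType) (x : nat -> X)
    (A : set X) (d : R) : Prop :=
  (#|` fset_set (A `&` x @` `I_n)|%:R / n%:R : R) @[n --> \oo] --> d.

(* Main.v *)
(* Consecutive fractions of a Stern-Brocot level have determinant 1, so their
   parities differ, and the parity of the mediant is the third one.  Hence, with
   the parities encoded in Z/3, every level, as well as the list of the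
   fractions newly inserted in it, is an arithmetic progression with nonzero
   step in Z/3: any three consecutive terms contain each parity once.  So the
   number of terms of a given parity among the first k terms of a level differs
   from k/3 by less than 1, and the error accumulated over the first n terms of
   the whole enumeration is only O(log n). *)

Require Import Defs.
From HB Require Import structures.
From mathcomp Require Import all_boot all_order all_algebra finmap.
From mathcomp Require Import zify ring lra.
From mathcomp Require Import all_classical all_reals all_analysis.

Set Implicit Arguments.
Unset Strict Implicit.
Unset Printing Implicit Defensive.

Import Order.TTheory GRing.Theory Num.Theory.
Import numFieldNormedType.Exports.
Local Open Scope classical_set_scope.
Local Open Scope ring_scope.

(** * Structure of the Stern-Brocot levels *)

Definition frac (p : nat * nat) : rat := p.1%:R / p.2%:R.

Definition sb_seq (J : nat) : seq (nat * nat) :=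
  flatten [seq sb_new j | j <- iota 1 J].

(** The determinant 1 condition, written without subtraction because entries are in [nat]. *)
Definition sb_adj (p q : nat * nat) : bool := (q.1 * p.2 == p.1 * q.2 + 1)%N.

(* 0, 1 and -1 stand for even, odd and none. *)
Definition parity (p : nat * nat) : 'Z_3 :=
  if odd p.2 then (odd p.1)%:R else -1.

Definition parity_step (c : 'Z_3) (p q : nat * nat) : bool :=
  parity q == parity p + c.

Lemma sb_refine_cons p t : sb_refine (p :: t) = p :: behead (sb_refine (p :: t)).
Proof. by case: t. Qed.

(** Two relations are allowed because the parity step changes sign under refinement. *)
Lemma sorted_sb_refine (e e' : rel (nat * nat)) s :
    (forall p q, e p q -> e' p (mediant p q) && e' (mediant p q) q) ->
  sorted e s -> sorted e' (sb_refine s).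
Proof.
move=> ee'; case: s => [|p t] //; rewrite sb_refine_cons /=.
elim: t p => [|q t IHt] p //= /andP[/ee' /andP[-> /= epq] /IHt].
by rewrite -/(sb_refine (q :: t)) (sb_refine_cons q t) /= epq.
Qed.

Lemma perm_sb_refine s : perm_eq (sb_refine s) (s ++ sb_mediants s).
Proof.
case: s => [|p t] //; elim: t p => [|q t IHt] p //.
rewrite -[sb_refine _]/(p :: mediant p q :: sb_refine (q :: t)).
rewrite -[sb_mediants _]/(mediant p q :: sb_mediants (q :: t)) /= perm_cons.
rewrite perm_sym -(cat1s _ (pairmap _ _ _)) -cat_cons perm_catCA /= perm_cons.
by rewrite perm_sym; apply: IHt.
Qed.

Lemma sb_seqS J : sb_seq J.+1 = sb_seq J ++ sb_mediants (sb_level J).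
Proof. by rewrite /sb_seq -[J.+1]addn1 iotaD map_cat flatten_cat /= cats0. Qed.

(** Lets size and distinctness of the enumerated fractions be read off from a level. *)
Lemma perm_sb_level J :
  perm_eq (sb_level J) ([:: (0, 1); (1, 0)]%N ++ sb_seq J).
Proof.
elim: J => [|J IHJ] //; rewrite sb_seqS catA.
by apply: perm_trans (perm_sb_refine _) _; rewrite perm_cat2r.
Qed.

Lemma size_sb_level J : size (sb_level J) = (2 ^ J).+1.
Proof.
have szm s : s != [::] -> (size (sb_mediants s)).+1 = size s.
  by case: s => //= p t _; rewrite size_pairmap.
elim: J => [|J IHJ] //=; rewrite (perm_size (perm_sb_refine _)) size_cat.
have := szm (sb_level J); rewrite -size_eq0 IHJ => /(_ isT).
by rewrite expnS mul2n -addnn => -[->].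
Qed.

Lemma size_sb_seq J : size (sb_seq J) = (2 ^ J).-1.
Proof. by have /perm_size := perm_sb_level J; rewrite size_sb_level /=; lia. Qed.

Lemma sb_adj_mediant p q :
  sb_adj p q -> sb_adj p (mediant p q) && sb_adj (mediant p q) q.
Proof. by rewrite /sb_adj /=; lia. Qed.

Lemma sb_adj_sb_level J : sorted sb_adj (sb_level J).
Proof. by elim: J => //= J; apply/sorted_sb_refine/sb_adj_mediant. Qed.

(* Levels are strictly sorted as fractions; the cross-product order is
   transitive even on pairs with zero entries. *)
Lemma uniq_sb_seq J : uniq (sb_seq J).
Proof.
suff: uniq (sb_level J).
  by rewrite (perm_uniq (perm_sb_level J)) cat_uniq => /and3P[].
pose lt (p q : nat * nat) := (p.1 * q.2 < q.1 * p.2)%N.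
apply: (@sorted_uniq _ lt); last 1 first.
- apply: sub_sorted (sb_adj_sb_level J) => p q; rewrite /sb_adj /lt; lia.
- move=> q p r; rewrite /lt => pq qr.
  have p2 : (0 < p.2)%N by move: pq; case: p.2; lia.
  have q2 : (0 < q.2)%N by move: qr; case: q.2; lia.
  rewrite -(ltn_pmul2r q2).
  apply: (@leq_ltn_trans (q.1 * r.2 * p.2)).
    by rewrite mulnAC [leqRHS]mulnAC leq_mul2r [X in _ || X](ltnW pq) orbT.
  by rewrite [ltnRHS]mulnAC ltn_pmul2r.
- by move=> p; rewrite /lt ltnn.
Qed.

Lemma all_sb_mediants s : sorted sb_adj s ->
  all (fun p => [&& (0 < p.1)%N, (0 < p.2)%N & coprime p.1 p.2]) (sb_mediants s).
Proof.
case: s => //= p t; elim: t p => //= q t IHt p /andP[pq /IHt ->]; rewrite andbT.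
move: pq; rewrite /sb_adj /mediant /=; case: p q => a b [c d] /= /eqP e.
have b0 : (0 < b)%N by move: e; case: (b); lia.
have c0 : (0 < c)%N by move: e; case: (c); lia.
apply/and3P; split; [lia..|].
(* Bezout: b(a + c) - a(b + d) = bc - ad = 1. *)
apply/coprimeP; [lia|]; exists (b, a) => /=; nia.
Qed.

Lemma all_sb_seq J :
  all (fun p => [&& (0 < p.1)%N, (0 < p.2)%N & coprime p.1 p.2]) (sb_seq J).
Proof.
elim: J => // J IHJ; rewrite sb_seqS all_cat IHJ /=.
exact/all_sb_mediants/sb_adj_sb_level.
Qed.

(** * Parities as arithmetic progressions in Z/3 *)

Lemma Zp3_cases (P : 'Z_3 -> Prop) : P 0 -> P 1 -> P (-1) -> forall c, P c.
Proof.
move=> P0 P1 P2 [[|[|[|//]]] ltc].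
- by rewrite (_ : Ordinal _ = 0) //; apply/val_inj.
- by rewrite (_ : Ordinal _ = 1) //; apply/val_inj.
- by rewrite (_ : Ordinal _ = -1) //; apply/val_inj.
Qed.

(** The elements of Z/3 sum to 0, so the third parity is minus the sum of the two others. The
    determinant modulo 2 leaves finitely many cases. *)
Lemma parity_mediant p q : sb_adj p q ->
  parity (mediant p q) = - (parity p + parity q).
Proof.
move=> /eqP /(congr1 odd); rewrite addn1 /= !oddM /parity /= !oddD.
by case: (odd p.1) (odd p.2) (odd q.1) (odd q.2) => [] [] [] [] // _;
  apply/val_inj.
Qed.

(** The mediant of parities x and x + c has parity -(2x + c) = x - c, so a step c is replaced by two
    steps -c. *)
Lemma parity_step_sb_level J :
  exists2 c : 'Z_3, c != 0 &
    sorted (fun p q => sb_adj p q && parity_step c p q) (sb_level J).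
Proof.
elim: J => [|J [c c0 IHJ]]; first by exists (-1).
exists (- c); first by rewrite oppr_eq0.
apply: sorted_sb_refine IHJ => p q /andP[pq].
have /andP[-> ->] := sb_adj_mediant pq.
rewrite /parity_step parity_mediant // => /eqP -> /=.
by move: (parity p) c {c0}; do 2![elim/Zp3_cases].
Qed.

(** Mediants have the parity of their left parent shifted by -c, so the step stays c. *)
Lemma parity_step_sb_mediants s (c : 'Z_3) :
  sorted (fun p q => sb_adj p q && parity_step c p q) s ->
  sorted (parity_step c) (sb_mediants s).
Proof.
case: s => // p [|q t] //=; elim: t p q => //= r t IHt p q.
move=> /and3P[/andP[pq sq] /andP[qr sr] t_path].
rewrite IHt ?qr ?sr // andbT /parity_step !parity_mediant //.
move/eqP: sr => ->; move/eqP: sq => ->.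
by move: (parity p) c {IHt t_path}; do 2![elim/Zp3_cases].
Qed.

(** Removing three consecutive terms removes each parity once; the at most two terms left have
    distinct parities. *)
Lemma count_parity_step (a c : 'Z_3) s : c != 0 -> sorted (parity_step c) s ->
  (size s <= 3 * count (fun p => parity p == a) s + 2)%N
  /\ (3 * count (fun p => parity p == a) s <= size s + 2)%N.
Proof.
move=> c0; elim: {s}_.+1 {-2}s (ltnSn (size s)) => // m IHm.
move=> [|p [|q [|r s]]] //= sm.
- by case: (_ == a).
- rewrite andbT /parity_step => /eqP ->.
  move: (parity p) c a c0 {IHm}.
  by do 3![elim/Zp3_cases].
move=> /and3P[/eqP pq /eqP qr rs].
have [||h1 h2] := IHm s; [by lia|exact: path_sorted rs|].
suff : ((parity p == a) + ((parity q == a) + (parity r == a)) = 1)%N by lia.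
rewrite qr pq; move: (parity p) c a c0 {pq qr rs IHm h1 h2 sm}.
by do 3![elim/Zp3_cases].
Qed.

(** Each level, complete or cut by [k], adds at most 2 to the error. *)
Lemma count_sb_seq (a : 'Z_3) J k : (k <= size (sb_seq J))%N ->
  (k <= 3 * count (fun p => parity p == a) (take k (sb_seq J)) + 2 * J)%N
  /\ (3 * count (fun p => parity p == a) (take k (sb_seq J)) <= k + 2 * J)%N.
Proof.
elim: J k => [|J IHJ] k; first by rewrite /sb_seq /=; case: k.
rewrite sb_seqS size_cat take_cat => kle; case: ltnP => [kJ|Jk].
  by have [] := IHJ k (ltnW kJ); lia.
have [] := IHJ _ (leqnn _); rewrite take_size => h1 h2.
have [c c0 /parity_step_sb_mediants sJ] := parity_step_sb_level J.
have := count_parity_step a c0 (take_sorted (k - size (sb_seq J)) sJ).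
by rewrite count_cat size_takel; lia.
Qed.

(** * The enumerations and their injectivity *)

Lemma sb_seqD I J : exists t, sb_seq (I + J) = sb_seq I ++ t.
Proof. by rewrite /sb_seq iotaD map_cat flatten_cat; eexists. Qed.

Lemma sb_enumE J k : (k < size (sb_seq J))%N ->
  sb_enum k = frac (nth (0, 1)%N (sb_seq J) k).
Proof.
move=> kJ; rewrite /sb_enum -/(sb_seq k.+1) -/(frac _); congr frac.
have kk : (k < size (sb_seq k.+1))%N.
  by rewrite size_sb_seq; have := ltn_expl k.+1 (ltnSn 1); lia.
(* Both lists are prefixes of one longer list, so they agree at [k]. *)
have [t Et] := sb_seqD k.+1 J; have [u Eu] := sb_seqD J k.+1.
have := congr1 (fun s => nth (0, 1)%N s k) Et.
by rewrite addnC Eu !nth_cat kk kJ => ->.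
Qed.

Lemma numq_frac p : (0 < p.2)%N -> coprime p.1 p.2 -> numq (frac p) = p.1.
Proof.
case: p => m n /= n0 mn; rewrite /frac /= !pmulrn coprimeq_num //.
by rewrite gtr0_sg ?mul1r.
Qed.

Lemma denq_frac p : (0 < p.2)%N -> coprime p.1 p.2 -> denq (frac p) = p.2.
Proof.
case: p => m n /= n0 mn; rewrite /frac /= !pmulrn coprimeq_den //.
by case: n n0 {mn}.
Qed.

Lemma sb_enum_gt0 k : 0 < sb_enum k.
Proof.
have kk : (k < size (sb_seq k.+1))%N.
  by rewrite size_sb_seq; have := ltn_expl k.+1 (ltnSn 1); lia.
rewrite (sb_enumE kk).
have /and3P[p1 p2 _] := allP (all_sb_seq k.+1) _ (mem_nth (0, 1)%N kk).
by rewrite divr_gt0 ?ltr0n.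
Qed.

Lemma sb_enum_inj : injective sb_enum.
Proof.
move=> i j; set J := (maxn i j).+1.
have sz k : (k < J)%N -> (k < size (sb_seq J))%N.
  by rewrite size_sb_seq; have := ltn_expl J (ltnSn 1); lia.
have iJ : (i < size (sb_seq J))%N by apply: sz; rewrite ltnS leq_maxl.
have jJ : (j < size (sb_seq J))%N by apply: sz; rewrite ltnS leq_maxr.
rewrite (sb_enumE iJ) (sb_enumE jJ) => e.
have /and3P[_ pi ci] := allP (all_sb_seq J) _ (mem_nth (0, 1)%N iJ).
have /and3P[_ pj cj] := allP (all_sb_seq J) _ (mem_nth (0, 1)%N jJ).
have := congr1 numq e; have := congr1 denq e.
rewrite !numq_frac // !denq_frac // => -[e2] [e1].
apply/eqP; rewrite -(nth_uniq (0, 1)%N iJ jJ (uniq_sb_seq J)).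
by rewrite [nth _ _ i]surjective_pairing [nth _ _ j]surjective_pairing e1 e2.
Qed.

(** The sign separates 0, the q_k and the -q_k. *)
Lemma sb_enum_rat_inj : injective sb_enum_rat.
Proof.
have qN i j : sb_enum i = - sb_enum j -> False.
  by move=> e; have := sb_enum_gt0 i; rewrite e oppr_gt0 ltNge ltW ?sb_enum_gt0.
have n0 i : sb_enum_rat i.+1 <> 0.
  by move=> /eqP; rewrite /=; case: odd; rewrite ?oppr_eq0 gt_eqF ?sb_enum_gt0.
move=> [|i] [|j] //; [by move/esym/n0|by move/n0|].
have half_inj : odd i = odd j -> i./2 = j./2 -> i.+1 = j.+1 by lia.
rewrite /=; case: (odd i) (odd j) half_inj => [] [] half_inj.
- by move=> /oppr_inj/sb_enum_inj/half_inj; apply.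
- by move/esym/qN.
- by move/qN.
- by move=> /sb_enum_inj/half_inj; apply.
Qed.

(** * From cardinalities to counts in the list of fractions *)

Lemma card_fset_set_first (T : choiceType) (x : nat -> T) (A : set T) n :
  injective x ->
  #|` fset_set (A `&` x @` `I_n)| = count (fun i => x i \in A) (iota 0 n).
Proof.
move=> x_inj; set s := [seq x i | i <- iota 0 n & x i \in A].
have fin : finite_set (A `&` x @` `I_n).
  by apply: finite_setIr; apply: finite_image; apply: finite_II.
have -> : fset_set (A `&` x @` `I_n) = seq_fset tt s.
  apply/fsetP => y; rewrite in_fset_set // seq_fsetE.
  apply/idP/mapP => [|[i]].
    rewrite inE => -[Ay [i /= lt_in xi]]; exists i => //.
    by rewrite mem_filter mem_iota xi /= add0n lt_in andbT inE.
  rewrite mem_filter mem_iota /= add0n => /andP[xA lt_in] ->.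
  by rewrite inE; split; [move: xA; rewrite inE | exists i].
rewrite size_seq_fset undup_id ?size_map ?size_filter //.
by rewrite map_inj_uniq ?filter_uniq ?iota_uniq.
Qed.

Lemma count_sb_enum_rat (A : set rat) n :
    (forall x, (- x \in A) = (x \in A)) ->
  let G m := count (fun i => sb_enum i \in A) (iota 0 m) in
  count (fun i => sb_enum_rat i \in A) (iota 0 n.+1) =
  (((0 : rat) \in A) + (G (uphalf n) + G n./2))%N.
Proof.
move=> AN G; elim: n => [|n IHn]; first by rewrite /G /= addn0.
rewrite -[n.+2]addn1 iotaD count_cat IHn add0n /=.
have -> : ((if odd n then - sb_enum n./2 else sb_enum n./2) \in A) =
    (sb_enum n./2 \in A).
  by case: odd.
(* Passing from [n] to [n.+1] turns ([uphalf n], [n./2]) into ([n./2.+1], [uphalf n]). *)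
have -> : G n./2.+1 = (G n./2 + (sb_enum n./2 \in A))%N.
  by rewrite /G -[n./2.+1]addn1 iotaD count_cat /= addn0.
lia.
Qed.

Lemma count_sb_enum (A : set rat) (a : 'Z_3) J k :
    (forall p, (0 < p.2)%N -> coprime p.1 p.2 ->
      (frac p \in A) = (parity p == a)) ->
    (k <= size (sb_seq J))%N ->
  count (fun i => sb_enum i \in A) (iota 0 k) =
  count (fun p => parity p == a) (take k (sb_seq J)).
Proof.
move=> Aa kJ; rewrite -(map_nth_iota0 (0, 1)%N kJ) count_map.
apply: eq_in_count => i; rewrite mem_iota /= add0n => ik.
have iJ := leq_trans ik kJ.
have /and3P[_ p2 p12] := allP (all_sb_seq J) _ (mem_nth (0, 1)%N iJ).
by rewrite (sb_enumE iJ) Aa.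
Qed.

(** * Error estimate and limit *)

Lemma sqr_le_exp2 J : (J ^ 2 <= 2 * 2 ^ J)%N.
Proof.
(* Induction starts at 3, from where (m + 1)^2 <= 2 m^2. *)
case: J => [|[|[|J]]] //; elim: J => // J; rewrite (expnS 2 J.+3).
by rewrite -!mulnn; set m := (2 ^ _)%N; nia.
Qed.

(** An error O(sqrt n) suffices; squaring it keeps the hypothesis within [nat]. *)
Lemma cvg_third (R : realType) (c : nat -> nat) (C : nat) :
    (forall n, (0 < n)%N -> exists e,
       [/\ n <= 3 * c n + e, 3 * c n <= n + e & e ^ 2 <= C * n]%N) ->
  ((c n)%:R / n%:R : R) @[n --> \oo] --> (1 / 3 : R).
Proof.
move=> ce; apply/cvgrPdist_le => eps eps0; near=> n.
have n0 : (0 < n)%N by near: n; exact: nbhs_infty_gt.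
(* This threshold gives e^2 <= C n <= (eps n)^2. *)
have nC : C%:R / eps ^+ 2 <= n%:R :> R by near: n; exact: nbhs_infty_ger.
have [e [h1 h2 h3]] := ce n n0.
set N : R := n%:R in nC *; have N0 : 0 < N by rewrite ltr0n.
have eN : e%:R <= eps * N.
  suff: e%:R ^+ 2 <= (eps * N) ^+ 2.
    by rewrite ler_sqr ?nnegrE // mulr_ge0 // ltW.
  rewrite -natrX.
  apply: (@le_trans _ _ (C * n)%:R); first by rewrite ler_nat.
  rewrite natrM exprMn [N ^+ 2]expr2 mulrA ler_wpM2r ?(ltW N0) //.
  by rewrite mulrC -ler_pdivrMr ?exprn_gt0.
have -> : 1 / 3 - (c n)%:R / N = (N - 3 * (c n)%:R) / (3 * N).
  by field; rewrite gt_eqF.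
rewrite normrM normfV [X in _ / X]gtr0_norm ?mulr_gt0 // ler_pdivrMr ?mulr_gt0 //.
have l1 : N <= 3 * (c n)%:R + e%:R by rewrite -natrM -natrD ler_nat.
have l2 : 3 * (c n)%:R <= N + e%:R by rewrite -natrM -natrD ler_nat.
have epsN : 0 <= eps * N by rewrite mulr_ge0 ?(ltW N0) ?(ltW eps0).
by rewrite mulrCA ler_norml; apply/andP; split; lra.
Unshelve. all: by end_near. Qed.

Lemma has_density_third (R : realType) (A : set rat) (a : 'Z_3) :
    (forall x, (- x \in A) = (x \in A)) ->
    (forall p, (0 < p.2)%N -> coprime p.1 p.2 ->
      (frac p \in A) = (parity p == a)) ->
  has_density sb_enum_rat A (1 / 3 : R).
Proof.
move=> AN Aa; rewrite /has_density.
under eq_cvg do rewrite (card_fset_set_first _ _ sb_enum_rat_inj).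
(* The error is 4 J + 2, and (4 J + 2)^2 <= 36 J^2 <= 72 * 2^J <= 144 (n + 1). *)
apply: (@cvg_third _ _ 144) => -[//|n] _; rewrite count_sb_enum_rat //.
have n2 := trunc_log_ltn n (ltnSn 1); have := trunc_logP (ltnSn 1) (ltn0Sn n).
have lt_log := leq_trunc_log 2 (leqnSn n).
(* Since n < 2^J, the first [J] levels suffice. The upper bound on 2^J uses the logarithm of [n.+1],
   as [n] may be 0. *)
set J := (trunc_log 2 n).+1 in n2 *; move=> Jn.
have J2 : (2 ^ J <= 2 * n.+1)%N.
  by rewrite expnS leq_mul2l /=; apply: leq_trans Jn; rewrite leq_exp2l.
have sJ : size (sb_seq J) = (2 ^ J).-1 by exact: size_sb_seq.
have kJ : (uphalf n <= size (sb_seq J))%N by rewrite sJ; lia.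
have lJ : (n./2 <= size (sb_seq J))%N by rewrite sJ; lia.
rewrite (count_sb_enum Aa kJ) (count_sb_enum Aa lJ).
have [h1 h2] := count_sb_seq a kJ; have [h3 h4] := count_sb_seq a lJ.
(* Each of the two prefixes contributes [2 * J], and the initial term 0 at most 2. *)
exists (4 * J + 2)%N; split.
- by case: (0 \in A); lia.
- by case: (0 \in A); lia.
- by have := sqr_le_exp2 J; nia.
Qed.

(** * The three parity classes *)

Lemma mem_parity_class (x : rat) :
  [/\ (x \in ratE) = ~~ odd `|numq x|,
      (x \in ratO) = odd `|numq x| && odd `|denq x|
    & (x \in ratN) = ~~ odd `|denq x|].
Proof.
have in_set (b : pred rat) : (x \in [set y | b y]) = b x.
  by apply/idP/idP; rewrite inE.
by rewrite /ratE /ratO /ratN !in_set !dvdzE /= !dvdn2 !negbK.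
Qed.

Lemma frac_parity (p : nat * nat) : (0 < p.2)%N -> coprime p.1 p.2 ->
  [/\ (frac p \in ratE) = (parity p == 0),
      (frac p \in ratO) = (parity p == 1)
    & (frac p \in ratN) = (parity p == -1)].
Proof.
move=> p2 cp; have [-> -> ->] := mem_parity_class (frac p).
rewrite numq_frac // denq_frac // /parity /=.
(* Lowest terms exclude even over even, where [parity] would give -1 despite an even numerator. *)
have : odd p.1 || odd p.2.
  by rewrite -[_ || _]negbK negb_or -!dvdn2 -dvdn_gcd (eqP cp).
by case: (odd p.1) (odd p.2) => [] [].
Qed.

Theorem theorem2 (R : realType) :
  [/\ has_density sb_enum_rat ratE (1 / 3 : R),
      has_density sb_enum_rat ratO (1 / 3 : R)
    & has_density sb_enum_rat ratN (1 / 3 : R)].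
Proof.
split; [apply: (@has_density_third _ _ 0) | apply: (@has_density_third _ _ 1)
  | apply: (@has_density_third _ _ (-1))];
  try by move=> p p2 cp; have [] := frac_parity p2 cp.
all: move=> x; have [e1 o1 n1] := mem_parity_class x;
  have [e2 o2 n2] := mem_parity_class (- x).
- by rewrite e1 e2 numqN abszN.
- by rewrite o1 o2 numqN denqN abszN.
- by rewrite n1 n2 denqN.
Qed.
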